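(* Let $X$ be a set, $(\mathfrak{B},\beta)$ a numbered set of subsets of $X$, and $\mathring{\subseteq}$ a strong inclusion relation for the induced numbered basis $(\hat{\mathfrak{B}},\hat\beta)$ for which every point of $X$ admits a strong neighborhood basis. Then the three multi-representations $\rho_{\beta}^{\min}$, $\rho_{\beta}^{\max}$ and $\rho_{\beta}^{\mathring{\subseteq}}$ are admissible with respect to the topology on $X$ generated by $\mathfrak{B}$ as a subbasis.
   Context: A multi-representation of $X$ is a partial multi-valued map $\rho:\subseteq\mathbb{N}^{\mathbb{N}}\rightrightarrows X$ (an assignment $f\mapsto\rho(f)\subseteq X$, $\text{dom}(\rho)=\{f:\rho(f)\neq\emptyset\}$) with every point in some $\rho(f)$. For multi-representations $\rho_1,\rho_2$, $\rho_1\le_t\rho_2$ means there is a continuous partial $F:\subseteq\mathbb{N}^{\mathbb{N}}\to\mathbb{N}^{\mathbb{N}}$ defined on $\text{dom}(\rho_1)$ with $\rho_1(f)\subseteq\rho_2(F(f))$ for all $f\in\text{dom}(\rho_1)$. A multi-function $F:Y\rightrightarrows Z$ between topological spaces is sequentially continuous if for every sequence $y_n\to y_\infty$ in $Y$, every choice $z_n\in F(y_n)$ and every $z_\infty\in F(y_\infty)$, the sequence $(z_n)$ converges to $z_\infty$. A multi-representation $\rho$ of a topological space $X$ is admissible if it is sequentially continuous (as a multi-function from $\text{dom}(\rho)$ with the subspace topology of Baire space to $X$) and every sequentially continuous multi-representation $\phi$ of $X$ satisfies $\phi\le_t\rho$. Numbered set: countable $\mathfrak{B}\subseteq\mathcal{P}(X)$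 with a partial surjection $\beta:\subseteq\mathbb{N}\to\mathfrak{B}$. With $\Delta$ the standard numbering of finite subsets of $\mathbb{N}$: $\text{dom}(\hat\beta)=\{n:\Delta_n\subseteq\text{dom}(\beta)\}$, $\hat\beta(n)=\bigcap_{k\in\Delta_n}\beta(k)$ (empty intersection $=X$). A strong inclusion relation for $(\hat{\mathfrak{B}},\hat\beta)$ is a transitive relation $\mathring{\subseteq}$ on $\text{dom}(\hat\beta)$ with $b_1\mathring{\subseteq}b_2\Rightarrow\hat\beta(b_1)\subseteq\hat\beta(b_2)$. $S\subseteq\text{dom}(\hat\beta)$ is a strong neighborhood basis of $x$ if $x\in\hat\beta(b)$ for all $b\in S$ and for each $b_1$ with $x\in\hat\beta(b_1)$ some $b_2\in S$ has $b_2\mathring{\subseteq}b_1$. $x\in\rho_\beta^{\min}(f)$ iff every $f(n)\in\text{dom}(\beta)$ with $x\in\beta(f(n))$, and for every $B\in\mathfrak{B}$ with $x\in B$ there are $n_1,\dots,n_k$ with $\beta(f(n_1))\cap\dots\cap\beta(f(n_k))\subseteq B$. $x\in\rho_\beta^{\max}(f)$ iff $\text{Im}(f)=\{n\in\text{dom}(\beta):x\in\beta(n)\}$. $x\in\rho_\beta^{\mathring{\subseteq}}(f)$ iff $\text{Im}(f)$ is a strong neighborhood basis of $x$.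
   Formalization: For the min and max multi-representations the formal theorem also assumes that the sets in 𝔅 cover X; otherwise a point in no member of 𝔅 has no name (e.g. 𝔅 empty, X a point) and the claim fails. The strong-inclusion one needs no such assumption. *)

(* Defs.v *)
From HB Require Import structures.
From mathcomp Require Import all_boot all_order all_algebra.
From mathcomp Require Import all_classical topology.

Set Implicit Arguments.
Unset Strict Implicit.
Unset Printing Implicit Defensive.

Local Open Scope classical_set_scope.

Definition baire := {ptws nat -> nat}.

(* A copy of X whose topology has the sets in B as a subbasis; B need not
   cover X, the empty intersection X being always open. *)
Definition subbase_topology (X : Type) (B : set (set X)) : Type := X.

HB.instance Definition _ (X : Type) (B : set (set X)) :=
  gen_eqMixin (subbase_topology B).
HB.instance Definition _ (X : Type) (B : set (set X)) :=
  gen_choiceMixin (subbase_topology B).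
HB.instance Definition _ (X : Type) (B : set (set X)) :=
  isSubBaseTopological.Build (subbase_topology B) B id.

Definition multi_dom (Y Z : Type) (F : Y -> set Z) : set Y :=
  [set y | F y !=set0].

Definition multi_representation (X : Type) (rho : baire -> set X) : Prop :=
  forall x, exists f, rho f x.

Definition seq_continuous (Y Z : topologicalType) (F : Y -> set Z) : Prop :=
  forall (y : nat -> Y) (y_oo : Y) (z : nat -> Z) (z_oo : Z),
    y @ \oo --> y_oo -> (forall n, F (y n) (z n)) -> F y_oo z_oo ->
    z @ \oo --> z_oo.

(* The library's [subspace A] keeps the points outside A, isolated; here they
   have empty values and are never selected. *)
Definition multi_seq_continuous (X : topologicalType) (rho : baire -> set X)
    : Prop :=
  @seq_continuous (subspace (multi_dom rho)) X rho.

(* D is the domain of the partial map F. *)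
Definition cont_reducible (X : Type) (rho1 rho2 : baire -> set X) : Prop :=
  exists (D : set baire) (F : baire -> baire),
    [/\ multi_dom rho1 `<=` D,
        {within D, continuous F} &
        forall f, multi_dom rho1 f -> rho1 f `<=` rho2 (F f)].

Definition admissible (X : topologicalType) (rho : baire -> set X) : Prop :=
  [/\ multi_representation rho,
      multi_seq_continuous rho &
      forall phi : baire -> set X,
        multi_representation phi -> multi_seq_continuous phi ->
        cont_reducible phi rho].

(* The partial surjection is a total function of which only the values on
   [ndom] matter. *)
Record numbered_set (X : Type) := NumberedSet {
  members : set (set X);
  ndom : set nat;
  num :> nat -> set X;
  num_surj : num @` ndom = members
}.

Lemma members_countable (X : Type) (beta : numbered_set X) :
  countable (members beta).
Proof. by rewrite -num_surj; exact: card_le_trans (card_image_le _ _) (countableP _). Qed.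

(* k belongs to Delta n iff the k-th binary digit of n is 1. *)
Definition Delta (n : nat) : set nat := [set k | odd (n %/ 2 ^ k)].

Definition hat (X : Type) (beta : numbered_set X) : numbered_set X :=
  @NumberedSet X _ [set n | Delta n `<=` ndom beta]
    (fun n => \bigcap_(k in Delta n) beta k) erefl.

Definition strong_inclusion (X : Type) (beta : numbered_set X)
    (R : nat -> nat -> Prop) : Prop :=
  [/\ forall b1 b2, R b1 b2 -> ndom beta b1 /\ ndom beta b2,
      forall b1 b2 b3, R b1 b2 -> R b2 b3 -> R b1 b3 &
      forall b1 b2, R b1 b2 -> beta b1 `<=` beta b2].

Definition strong_nbhd_basis (X : Type) (beta : numbered_set X)
    (R : nat -> nat -> Prop) (x : X) (S : set nat) : Prop :=
  [/\ S `<=` ndom beta,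
      forall b, S b -> beta b x &
      forall b1, ndom beta b1 -> beta b1 x -> exists2 b2, S b2 & R b2 b1].

Definition rho_min (X : Type) (beta : numbered_set X) (f : baire) : set X :=
  [set x | (forall n, ndom beta (f n) /\ beta (f n) x) /\
     forall B, members beta B -> B x ->
       exists s : seq nat, \bigcap_(n in [set` s]) beta (f n) `<=` B].

Definition rho_max (X : Type) (beta : numbered_set X) (f : baire) : set X :=
  [set x | range f = [set n | ndom beta n /\ beta n x]].

Definition rho_strong (X : Type) (beta : numbered_set X)
    (R : nat -> nat -> Prop) (f : baire) : set X :=
  [set x | strong_nbhd_basis (hat beta) R x (range f)].

(* A point in no member of the numbered set has no name under rho_min or
   rho_max, which are multi-representations only if this holds. *)
Definition covering (X : Type) (beta : numbered_set X) : Prop :=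
  \bigcup_(B in members beta) B = [set: X].

(* Main.v *)
(* Along a name [f] of [x] under a sequentially continuous [phi], a basic open
   set contains [x] iff it contains every [phi]-value over some cylinder around
   [f]: otherwise values outside it could be chosen over shrinking cylinders,
   and they would converge to [x].  Hence the indices of all basic sets around
   [x] can be enumerated continuously from [f], which reduces [phi] to [rho_max].
   Names for [rho_max beta] are names for [rho_min beta], and since every point
   has some strong neighborhood basis, names for [rho_max (hat beta)] are names
   for [rho_strong beta R]. *)
Require Import Defs.
From mathcomp Require Import all_boot all_classical topology.

Set Implicit Arguments.
Unset Strict Implicit.
Unset Printing Implicit Defensive.

Local Open Scope classical_set_scope.

(** * Subbases and the codes of finite intersections *)

Lemma subbase_open (X : Type) (B : set (set X)) (A : set X) :
  B A -> @open (subbase_topology B) A.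
Proof.
move=> BA; exists [set A]; last by rewrite bigcup_set1.
by move=> _ ->; exact: (@finI_from1 _ _ B id A BA).
Qed.

Lemma subbase_cvg (X : Type) (B : set (set X))
    (F : set_system (subbase_topology B)) (x : subbase_topology B) :
  Filter F -> (forall A, B A -> A x -> F A) -> F --> x.
Proof.
(* An open set is a union of finite intersections of members of [B]; [D] is one of these that
   contains [x]. *)
move=> FF FB A; rewrite nbhsE => -[_ [[C sC <-] [D CD Dx]] sA].
rewrite nbhs_filterE; apply: filterS sA _; apply: (@filterS _ _ _ D).
  by move=> y Dy; exists D.
have [E sE ED] := sC _ CD; rewrite -ED; apply: filter_bigI => G EG.
by apply: FB; [have /set_mem := sE _ EG | move: Dx; rewrite -ED; apply].
Qed.

(** The only nonzero binary digit of [2 ^ k] is the [k]-th; through these codes [beta] sits inside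
    [hat beta]. *)
Lemma Delta_pow k : Delta (2 ^ k) = [set k].
Proof.
rewrite eqEsubset; split=> [i|_ ->] /=; last first.
  by rewrite /Delta /= divnn expn_gt0.
rewrite /Delta /=; have [lt|lt|//] := ltngtP i k.
  by rewrite -(subnK (ltnW lt)) expnD mulnK ?expn_gt0// oddX subn_eq0 leqNgt lt.
by rewrite divn_small// ltn_exp2l.
Qed.

Lemma finite_Delta n : finite_set (Delta n).
Proof.
apply: (@sub_finite_set _ _ `I_n); last exact: finite_II.
(* Digits at places [k >= n] vanish because [n < 2 ^ n <= 2 ^ k]. *)
move=> k /=; rewrite /Delta /= ltnNge; apply: contraTN => lenk.
by rewrite divn_small// (leq_ltn_trans lenk)// ltn_expl.
Qed.

Lemma hat_pow (X : Type) (beta : numbered_set X) k : hat beta (2 ^ k) = beta k.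
Proof. by rewrite /= Delta_pow bigcap_set1. Qed.

Lemma ndom_hat_pow (X : Type) (beta : numbered_set X) k :
  ndom beta k -> ndom (hat beta) (2 ^ k).
Proof. by move=> bk; rewrite /= Delta_pow => _ ->. Qed.

Lemma num_members (X : Type) (beta : numbered_set X) k :
  ndom beta k -> members beta (beta k).
Proof. by move=> bk; rewrite -num_surj; exists k. Qed.

Lemma hat_open (X : topologicalType) (beta : numbered_set X) :
  members beta `<=` open -> members (hat beta) `<=` open.
Proof.
move=> bo _ [n dn <-]; rewrite openE => x nx; rewrite /interior /=.
have /finite_fsetP[E DE] := finite_Delta n.
rewrite DE; apply: filter_bigI => k Ek; have nk : Delta n k by rewrite DE.
by apply: open_nbhs_nbhs; split; [apply/bo/num_members/dn | exact: nx].
Qed.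

(** The code 0 stands for the empty intersection, which is all of [X]. *)
Lemma covering_hat (X : Type) (beta : numbered_set X) : covering (hat beta).
Proof.
rewrite /covering eqEsubset; split=> // x _.
have D0 : Delta 0 = set0.
  by rewrite eqEsubset; split=> // k; rewrite /Delta /= div0n.
by exists (hat beta 0); [apply: num_members|]; rewrite /= D0.
Qed.

(** * Cylinders as neighborhoods in Baire space *)

Definition agree (n : nat) (f g : baire) : Prop := forall i, i < n -> f i = g i.

Lemma agree_sym n f g : agree n f g -> agree n g f.
Proof. by move=> fg i /fg. Qed.

Lemma agree_trans n f g h : agree n f g -> agree n g h -> agree n f h.
Proof. by move=> fg gh i ltin; rewrite fg// gh. Qed.

Lemma agreeW m n f g : m <= n -> agree n f g -> agree m f g.
Proof. by move=> lemn fg i ltim; apply: fg; apply: leq_trans lemn. Qed.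

Lemma nbhs_agree (f : baire) n : nbhs f (agree n f).
Proof.
elim: n => [|n IHn]; first by apply: filterS filterT.
have fn : nbhs f [set g : baire | f n = g n].
  have := @proj_continuous nat (fun=> nat) n f [set m | f n = m].
  by apply; rewrite nbhs_principalE.
apply: filterS2 IHn fn => g fg gn i; rewrite ltnS leq_eqVlt => /predU1P[->//|].
exact: fg.
Qed.

(** Convergence is coordinatewise, and a prefix of length [i.+1] fixes coordinate [i]. *)
Lemma cvg_agree (F : set_system baire) (f : baire) :
  Filter F -> (forall n, F (agree n f)) -> F --> f.
Proof.
move=> FF Ff; apply/pointwise_cvgP => i A.
rewrite nbhs_principalE => Af.
rewrite -[_ A]/(F [set g : baire | A (g i)]).
by apply: filterS (Ff i.+1) => g /= /(_ i (ltnSn i)) <-; exact: Af.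
Qed.

(** * Sequential continuity in terms of cylinders *)

Definition cylinder_in (X : Type) (rho : baire -> set X) (B : set X)
    (f : baire) (n : nat) : Prop :=
  forall g, agree n f g -> rho g `<=` B.

Lemma cylinder_in_agree (X : Type) (rho : baire -> set X) B f g n :
  agree n f g -> cylinder_in rho B f n -> cylinder_in rho B g n.
Proof. by move=> fg fB h gh; apply: fB; exact: agree_trans gh. Qed.

Lemma seq_continuous_cylinder_in (X : topologicalType) (rho : baire -> set X)
    B f x :
  multi_seq_continuous rho -> open B -> rho f x -> B x ->
  exists n, cylinder_in rho B f n.
Proof.
move=> rhoc Bo rfx Bx; apply: contrapT => /forallNP noB.
have /choice[u uP] n :
    exists gz : baire * X, [/\ agree n f gz.1, rho gz.1 gz.2 & ~ B gz.2].
  apply: contrapT => /forallNP nogz; apply: (noB n) => g fg z rgz.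
  by apply: contrapT => nBz; apply: (nogz (g, z)).
(* Each name in [u] has a value, so convergence in Baire space passes to the subspace. *)
have uf : (fst \o u) @ \oo --> (f : subspace (multi_dom rho)).
  apply/subspace_cvgP; first by exists x.
  move=> A /= fA.
  have : (fst \o u) @ \oo --> f.
    apply: cvg_agree => n; exists n => // m /= lenm.
    by have [fu _ _] := uP m; exact: agreeW fu.
  move=> /(_ _ fA)[N _ NA]; exists N => // n /NA /=; apply.
  by have [_ ruz _] := uP n; exists (u n).2.
have ux : (snd \o u) @ \oo --> x.
  by apply: (rhoc _ _ _ _ uf) => // n; have [] := uP n.
have [N _ /(_ N (leqnn N))] := ux _ (open_nbhs_nbhs (conj Bo Bx)).
by have [_ _] := uP N.
Qed.

(** Names converging to [f] eventually enter the cylinder, which traps the chosen values in [A];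
    testing subbasic [A] suffices. *)
Lemma cylinder_in_seq_continuous (X : Type) (B : set (set X))
    (rho : baire -> set X) :
  (forall f x A, rho f x -> B A -> A x -> exists n, cylinder_in rho A f n) ->
  @multi_seq_continuous (subbase_topology B) rho.
Proof.
move=> rhoB y f z x yf ryz rfx; apply: subbase_cvg => A BA Ax.
have [n fA] := rhoB _ _ _ rfx BA Ax.
have fdom : multi_dom rho f by exists x.
have yf' := (@subspace_cvgP baire (multi_dom rho) _ f _ fdom).1 yf.
have /yf'[N _ Ny] : within (multi_dom rho) (nbhs (f : baire)) (agree n f).
  by apply: (filterS _ (nbhs_agree f n)) => g.
by exists N => // m /Ny /= /fA; apply; exact: ryz.
Qed.

(** * Continuous enumeration of the indices around a point *)

Section Enumeration.
Variables (X : topologicalType) (beta : numbered_set X) (phi : baire -> set X).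

(** Codes a candidate index and a prefix length. The default [(0, 0)] is harmless, being tested like
    any other pair. *)
Let pair_of (m : nat) : nat * nat := odflt (0, 0) (unpickle m).

Let pair_ofK k n : pair_of (pickle (k, n)) = (k, n).
Proof. by rewrite /pair_of pickleK. Qed.

(** Decided classically; what matters is that the answer depends only on a finite prefix of [f]. *)
Definition confirmed (f : baire) (m : nat) : bool :=
  `[< ndom beta (pair_of m).1 /\
      cylinder_in phi (beta (pair_of m).1) f (pair_of m).2 >].

(* The first confirmed index pads the positions without a confirmation, so that
   nothing else is enumerated. *)
Definition enum_step (f : baire) (m : nat) : nat :=
  if confirmed f m then m
  else if pselect (exists m, confirmed f m) is left ex then ex_minn ex else 0.

Definition enumerate (f : baire) : baire := fun m => (pair_of (enum_step f m)).1.

Lemma confirmed_agree f g m :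
  agree (pair_of m).2 f g -> confirmed f m = confirmed g m.
Proof.
move=> fg; apply/asboolP/asboolP => -[dm fm]; split=> //.
  exact: cylinder_in_agree fm.
by apply: cylinder_in_agree fm; exact: agree_sym.
Qed.

Lemma enum_step_confirmed f m :
  (exists m, confirmed f m) -> confirmed f (enum_step f m).
Proof.
rewrite /enum_step => exm; case: ifP => // _.
by case: pselect => // ex; case: ex_minnP.
Qed.

Lemma confirmed_num f x m : phi f x -> confirmed f m ->
  ndom beta (pair_of m).1 /\ beta (pair_of m).1 x.
Proof. by move=> pfx /asboolP[? fm]; split=> //; exact: fm pfx. Qed.

Hypotheses (phic : multi_seq_continuous phi) (beta_open : members beta `<=` open).
Hypothesis (beta_cover : covering beta).

Lemma num_confirmed f x k : phi f x -> ndom beta k -> beta k x ->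
  exists2 m, confirmed f m & (pair_of m).1 = k.
Proof.
move=> pfx dk kx.
have bko := beta_open (num_members dk).
have [n fn] := seq_continuous_cylinder_in phic bko pfx kx.
by exists (pickle (k, n)); rewrite ?pair_ofK//; apply/asboolP; rewrite pair_ofK.
Qed.

(** By covering, a point named by [f] lies in some member, so the padding index exists on the whole
    domain. *)
Lemma ex_confirmed f : multi_dom phi f -> exists m, confirmed f m.
Proof.
move=> [x pfx]; have : [set: X] x by [].
rewrite -beta_cover => -[B] /=; rewrite -num_surj => -[k dk <-] kx.
by have [m fm _] := num_confirmed pfx dk kx; exists m.
Qed.

Lemma enumerate_rho_max f : phi f `<=` rho_max beta (enumerate f).
Proof.
move=> x pfx; have exm : exists m, confirmed f m by apply: ex_confirmed; exists x.
rewrite /rho_max /= eqEsubset; split=> [_ [m _ <-]|k [dk kx]] /=.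
  by apply: (confirmed_num pfx); exact: enum_step_confirmed.
have [m fm <-] := num_confirmed pfx dk kx.
by exists m; rewrite // /enumerate /enum_step fm.
Qed.

(** The first [N] steps depend on the tests below [N] and on those up to the padding index, which is
    at most [m0]: finitely many tests, each reading a finite prefix. *)
Lemma enum_step_agree f m0 N : confirmed f m0 -> exists n, forall g,
  agree n f g -> forall m, m < N -> enum_step f m = enum_step g m.
Proof.
move=> fm0; pose L := maxn N m0.+1.
exists (\max_(i < L) (pair_of i).2) => g fg m ltmN.
have fgE i : i < L -> confirmed f i = confirmed g i.
  move=> ltiL; apply/confirmed_agree/(agreeW _ fg).
  exact: (leq_bigmax (Ordinal ltiL)).
have ltm0 : m0 < L by rewrite /L leq_max leqnn orbT.
have gm0 : confirmed g m0 by rewrite -fgE.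
rewrite /enum_step -fgE; last by rewrite /L leq_max ltmN.
case: ifP => // _; case: pselect => [exf|[]]; last by exists m0.
case: pselect => [exg|[]]; last by exists m0.
(* Both least indices are at most [m0 < L], where the tests for [f] and [g] coincide, so each bounds
   the other. *)
case: ex_minnP => i fi mini; case: ex_minnP => j gj minj.
apply/eqP; rewrite eqn_leq mini ?minj ?fgE//.
  by rewrite -fgE// (leq_ltn_trans (mini _ fm0)).
by rewrite (leq_ltn_trans (minj _ gm0)).
Qed.

Lemma enumerate_continuous : {within multi_dom phi, continuous enumerate}.
Proof.
apply/subspace_continuousP => f domf; have [m0 fm0] := ex_confirmed domf.
apply: cvg_agree => N; have [n fgE] := enum_step_agree N fm0.
apply: filterS (nbhs_agree f n) => g /fgE fg _ m ltmN.
by rewrite /from_subspace /enumerate fg.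
Qed.

Lemma cont_reducible_rho_max : cont_reducible phi (rho_max beta).
Proof.
exists (multi_dom phi), enumerate; split=> //; first exact: enumerate_continuous.
by move=> f _; exact: enumerate_rho_max.
Qed.

End Enumeration.

(** * The three multi-representations *)

Lemma cont_reducibleS (X : Type) (phi rho rho' : baire -> set X) :
  (forall f, rho f `<=` rho' f) -> cont_reducible phi rho ->
  cont_reducible phi rho'.
Proof.
move=> rr' [D [F [dD Fc Frho]]]; exists D, F; split=> // f domf.
exact: subset_trans (Frho f domf) (rr' _).
Qed.

Lemma multi_representationS (X : Type) (rho rho' : baire -> set X) :
  (forall f, rho f `<=` rho' f) -> multi_representation rho ->
  multi_representation rho'.
Proof. by move=> rr' rrep x; have [f /rr'] := rrep x; exists f. Qed.

Lemma rho_max_multi_representation (X : Type) (beta : numbered_set X) :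
  covering beta -> multi_representation (rho_max beta).
Proof.
move=> bcov x; have : [set: X] x by [].
rewrite -bcov => -[B] /=; rewrite -num_surj => -[k dk <-] kx.
pose P n := ndom beta n /\ beta n x.
(* The index [k] of a member around [x] fills the positions [n] that fail [P]. *)
exists (fun n => if `[< P n >] then n else k); rewrite /rho_max /= eqEsubset.
split=> [_ [n _ <-]|n Pn]; first by case: asboolP.
by exists n => //; case: asboolP.
Qed.

Lemma rho_max_sub_min (X : Type) (beta : numbered_set X) f :
  rho_max beta f `<=` rho_min beta f.
Proof.
move=> x fx; split=> [n|B].
  by have : range f (f n) by []; rewrite fx.
rewrite -num_surj => -[k dk <-] kx.
have [n _ fnk] : range f k by rewrite fx.
by exists [:: n] => y /(_ n) /=; rewrite inE eqxx fnk; exact.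
Qed.

(** Enlarging a strong neighborhood basis by further indices of sets around [x] keeps it one. *)
Lemma rho_max_hat_sub_strong (X : Type) (beta : numbered_set X)
    (R : nat -> nat -> Prop) f :
  (forall x, exists S, strong_nbhd_basis (hat beta) R x S) ->
  rho_max (hat beta) f `<=` rho_strong beta R f.
Proof.
move=> Rb x fx; have [S [Sdom Sx SR]] := Rb x.
split=> [b|b|b1 d1 x1]; rewrite ?fx; [by case|by case|].
by have [b2 Sb2 R21] := SR _ d1 x1; exists b2 => //; split; auto.
Qed.

Lemma rho_min_cylinder_in (X : Type) (beta : numbered_set X) f x A :
  rho_min beta f x -> members beta A -> A x ->
  exists n, cylinder_in (rho_min beta) A f n.
Proof.
move=> [_ fx] bA Ax; have [s sA] := fx A bA Ax.
(* A prefix reaching past the largest position in [s] fixes the finite intersection inside [A]. *)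
exists (\max_(i <- s) i).+1 => g fg z [gz _]; apply: sA => i /= si.
by rewrite fg ?ltnS ?leq_bigmax_seq//; have [] := gz i.
Qed.

Lemma rho_max_cylinder_in (X : Type) (beta : numbered_set X) f x A :
  rho_max beta f x -> members beta A -> A x ->
  exists n, cylinder_in (rho_max beta) A f n.
Proof.
move=> rfx bA Ax; have fx := rho_max_sub_min rfx.
have [n fA] := rho_min_cylinder_in fx bA Ax.
by exists n => g /fA gA; apply: subset_trans gA; exact: rho_max_sub_min.
Qed.

(** One entry [f n] strongly included in the code [2 ^ k] of [A] confines all values to [A]. *)
Lemma rho_strong_cylinder_in (X : Type) (beta : numbered_set X)
    (R : nat -> nat -> Prop) f x A :
  strong_inclusion (hat beta) R ->
  rho_strong beta R f x -> members beta A -> A x ->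
  exists n, cylinder_in (rho_strong beta R) A f n.
Proof.
move=> [_ _ Rsub] [_ _ fx]; rewrite -num_surj => -[k dk <-].
rewrite -hat_pow => kx.
have [_ [n _ <-] /Rsub fnk] := fx _ (ndom_hat_pow dk) kx.
exists n.+1 => g fg z [_ gz _]; apply: fnk; apply: gz.
by exists n; rewrite ?fg.
Qed.

Theorem theorem3p2 (X : Type) (beta : numbered_set X)
    (R : nat -> nat -> Prop)
    (R_strong : strong_inclusion (hat beta) R)
    (R_basis : forall x : X, exists S : set nat,
        strong_nbhd_basis (hat beta) R x S) :
  [/\ covering beta ->
        @admissible (subbase_topology (members beta)) (rho_min beta),
      covering beta ->
        @admissible (subbase_topology (members beta)) (rho_max beta) &
      @admissible (subbase_topology (members beta)) (rho_strong beta R)].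
Proof.
pose T : topologicalType := subbase_topology (members beta).
have bo : members beta `<=` @open T by move=> A; exact: subbase_open.
have red_max (phi : baire -> set T) : covering beta ->
    multi_seq_continuous phi -> cont_reducible phi (rho_max beta).
  by move=> bcov phic; exact: (@cont_reducible_rho_max T beta).
split=> [bcov|bcov|]; split.
- apply: multi_representationS (@rho_max_sub_min X beta) _.
  exact: rho_max_multi_representation.
- apply: cylinder_in_seq_continuous => f x A.
  exact: rho_min_cylinder_in.
- move=> phi _ phic; apply: cont_reducibleS (@rho_max_sub_min X beta) _.
  exact: red_max.
- exact: rho_max_multi_representation.
- apply: cylinder_in_seq_continuous => f x A.
  exact: rho_max_cylinder_in.
- by move=> phi _; exact: red_max.
- apply: (@multi_representationS _ (rho_max (hat beta))); last first.
    exact/rho_max_multi_representation/covering_hat.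
  by move=> f; exact: rho_max_hat_sub_strong.
- apply: cylinder_in_seq_continuous => f x A.
  exact: rho_strong_cylinder_in.
- move=> phi _ phic; apply: (@cont_reducibleS _ _ (rho_max (hat beta))) => [f|].
    exact: rho_max_hat_sub_strong.
  (* Finite intersections are open in the same topology and cover [X], so the enumeration applies to
     [hat beta]. *)
  apply: (@cont_reducible_rho_max T (hat beta)) => //.
    exact: (@hat_open T).
  exact: covering_hat.
Qed.
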